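(* There exist constants $C>0$ and $N_0$ such that for every $N=2^n\ge N_0$ and every set $S$ of exactly $N$ distinct Boolean functions $f:\{0,1\}^n\to\{0,1\}$ (i.e. every $N\times N$ oracle identification problem), the bounded-error quantum query complexity $Q(S)$ of identifying the input oracle from $S$ satisfies $$Q(S)\le C\sqrt{N}.$$
   Context: Let $N=2^n$. An oracle is a Boolean function $f:\{0,1\}^n\to\{0,1\}$, and inputs are identified with integers $0,\dots,N-1$ via binary representation. A set $S=\{f_0,\dots,f_{M-1}\}$ of $M$ distinct oracles is viewed as a Boolean matrix with $M$ rows (oracles) and $N$ columns (inputs), called an $N\times M$ matrix. The $N\times M$ oracle identification problem (OIP) for $S$: the set $S$ is completely known, an unknown $f\in S$ (the input oracle) is given as a black box, and the task is to determine which element of $S$ it is. A quantum algorithm with $t$ queries is a sequence $U_0,O_f,U_1,O_f,\dots,O_f,U_t$ applied to a fixed initial state (with arbitrary finite workspace), followed by a measurement producing the output, where the $U_j$ are arbitrary unitaries independent of $f$ and $O_f$ maps $|x\rangle|b\rangle$ to $(-1)^{b\cdot f(x)}|x\rangle|b\rangle$ for $x\in\{0,1\}^n$, $b\in\{0,1\}$ (identity on the rest of the workspace). It solves the OIP for $S$ with bounded error if for every $f\in S$, when run with $O_f$, it outputs (the index of) $f$ with probability at least $2/3$. $Q(S)$ is the minimum $t$ for which such an algorithm exists. *)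

(* Defs.v *)
From HB Require Import structures.
From mathcomp Require Import all_boot all_order all_algebra.
From mathcomp Require Import reals.
From mathcomp Require Import complex.

Set Implicit Arguments.
Unset Strict Implicit.
Unset Printing Implicit Defensive.

Import Order.TTheory GRing.Theory Num.Theory.
Local Open Scope ring_scope.
Local Open Scope complex_scope.
Local Open Scope sesquilinear_scope.

Definition oracle (n : nat) := {ffun n.-tuple bool -> bool}.

(* Labels |x>|b>|w> of the computational basis: query register, phase-control
   qubit, and a workspace of dimension w. *)
Definition basis_label (n w : nat) : finType :=
  (n.-tuple bool * bool * 'I_w)%type.

Definition hdim (n w : nat) : nat := #|basis_label n w|.

(* O_f, diagonal in the computational basis, with the k-th matrix index
   standing for the k-th label in the enumeration of [basis_label n w]. *)
Definition oracle_mx (R : realType) (n w : nat) (f : oracle n) :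
    'M[R[i]]_(hdim n w) :=
  diag_mx (\row_k let: (x, b, _) := enum_val k in (-1) ^+ (b && f x)).

(* A projective measurement with outcomes in O: pairwise orthogonal
   self-adjoint projectors summing to the identity. *)
Record projective_measurement (R : realType) (O : finType) (d : nat)
    (P : O -> 'M[R[i]]_d) : Prop := ProjectiveMeasurement {
  meas_adjoint : forall o, (P o)^t* = P o;
  meas_orthogonal : forall o o',
    P o *m P o' = if o == o' then P o else 0;
  meas_complete : \sum_o P o = 1%:M
}.

(* None of the data may depend on the oracle.  Only the gates U_0, ..., U_t
   matter; [alg_gate] is arbitrary beyond t.  The measurement outcome is the
   guessed oracle itself, which carries the same information as its index. *)
Record query_algorithm (R : realType) (n t : nat) := QueryAlgorithm {
  alg_work : nat;
  alg_init : 'cV[R[i]]_(hdim n alg_work);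
  alg_init_unit : alg_init^t* *m alg_init = 1%:M;
  alg_gate : nat -> 'M[R[i]]_(hdim n alg_work);
  alg_gate_unitary : forall j, (j <= t)%N -> alg_gate j \is unitarymx;
  alg_meas : oracle n -> 'M[R[i]]_(hdim n alg_work);
  alg_meas_proj : projective_measurement alg_meas
}.

(* U_j O_f U_{j-1} ... O_f U_0 |init> *)
Fixpoint alg_state (R : realType) (n t : nat) (A : query_algorithm R n t)
    (f : oracle n) (j : nat) : 'cV[R[i]]_(hdim n (alg_work A)) :=
  if j is j'.+1 then
    alg_gate A j *m (oracle_mx R (alg_work A) f *m alg_state A f j')
  else alg_gate A 0 *m alg_init A.

(* Born rule <psi|P_g|psi>; the scalar is real, so taking the real part loses
   nothing. *)
Definition output_prob (R : realType) (n t : nat) (A : query_algorithm R n t)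
    (f g : oracle n) : R :=
  let psi := alg_state A f t in
  complex.Re ((psi^t* *m alg_meas A g *m psi) 0 0).

Definition solves_oip (R : realType) (n t : nat) (A : query_algorithm R n t)
    (S : {set oracle n}) : Prop :=
  forall f, f \in S -> 2 / 3 <= output_prob A f f.

Definition solvable_with (R : realType) (n : nat) (S : {set oracle n})
    (t : nat) : Prop :=
  exists A : query_algorithm R n t, solves_oip A S.

(* "Q(S) = q": q is the minimum of the set of sufficient query counts. *)
Definition is_query_complexity (R : realType) (n : nat) (S : {set oracle n})
    (q : nat) : Prop :=
  solvable_with R S q /\ forall t, solvable_with R S t -> (q <= t)%N.

(* Main.v *)
Require Import Defs.
From mathcomp Require Import all_boot all_order all_algebra.
From mathcomp Require Import reals.
From mathcomp Require Import boolp complex ring lra zify.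

Set Implicit Arguments.
Unset Strict Implicit.
Unset Printing Implicit Defensive.

Import Order.TTheory GRing.Theory Num.Theory.
Local Open Scope ring_scope.
Local Open Scope complex_scope.
Local Open Scope sesquilinear_scope.

(* A t-query algorithm is determined, up to unitaries independent of the oracle,
   by the Gram matrix K(f, g) = <psi_f, psi_g> of its final states: a query
   splits K into positive semidefinite pieces K_(x, b), one for each content of
   the query register, and multiplies each by (-1)^(b f(x)) (-1)^(b g(x)).
   Running a second algorithm controlled by the outcome of a first one is a sum
   of Hadamard products, so adaptive strategies need no explicit gates; gates
   are recovered at the end from Householder reflections.

   The strategy keeps a set T of candidates.  At most |T| columns separate the
   elements of T, and on these f either coincides with the pointwise majority of
   T, which identifies f, or disagrees with it at some column, which Grover
   search finds with O(sqrt |T|) queries and probability at least 1/4; querying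
   that column then halves T.  Spending i + 9 attempts on the i-th halving keeps
   the total error below 1/3, and the costs (i + 9) sqrt(N / 2^i) sum to
   O(sqrt N), without the factor log N of naive repeated halving. *)

(** * Gram matrices reachable with t queries *)

(** For injective [i] this is extension of [u] by zero along [i]; summing over the fibre avoids
    choosing preimages. *)
Definition pushforward (R : realType) (L M : finType) (i : L -> M) (u : L -> R)
    (k : M) : R := \sum_(l | i l == k) u l.

Lemma pushforward_dot (R : realType) (L M : finType) (i : L -> M)
    (u v : L -> R) (c : M -> R) :
  injective i ->
  \sum_k c k * (pushforward i u k * pushforward i v k) =
  \sum_l c (i l) * (u l * v l).
Proof.
move=> i_inj; rewrite [RHS](partition_big i predT) //=.
apply: eq_bigr => k _; rewrite /pushforward.
have [l /eqP <- | no] := pickP (fun l => i l == k).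
  by rewrite !(big_pred1 l) // => l'; rewrite inj_eq.
by rewrite !big_pred0 // mul0r mulr0.
Qed.

Definition is_gram (R : realType) (F : Type) (K : F -> F -> R) : Prop :=
  exists (L : finType) (v : F -> L -> R),
    forall f g, K f g = \sum_l v f l * v g l.

Lemma gram_eq (R : realType) (F : Type) (K K' : F -> F -> R) :
  (forall f g, K f g = K' f g) -> is_gram K -> is_gram K'.
Proof. by move=> KK' [L [v vK]]; exists L, v => f g; rewrite -KK'. Qed.

Lemma gram_rank1 (R : realType) (F : Type) (u : F -> R) :
  is_gram (fun f g => u f * u g).
Proof. by exists unit, (fun f _ => u f) => f g; rewrite big_const card_unit /= addr0. Qed.

Lemma gram_const (R : realType) (F : Type) (c : R) :
  0 <= c -> is_gram (fun _ _ : F => c).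
Proof.
move=> c0; apply: gram_eq (gram_rank1 (fun=> Num.sqrt c)) => f g.
by rewrite -expr2 sqr_sqrtr.
Qed.

Lemma gram_family (R : realType) (F : Type) (I : finType)
    (K : I -> F -> F -> R) :
  (forall i, is_gram (K i)) ->
  exists d : nat, forall w : nat, (d <= w)%N ->
    exists v : I -> F -> 'I_w -> R,
      forall i f g, K i f g = \sum_j v i f j * v i g j.
Proof.
move=> gK.
have {gK} [L gL] := choice gK.
pose v i := projT1 (cid (gL i)).
have vK i f g : K i f g = \sum_l v i f l * v i g l := projT2 (cid (gL i)) f g.
exists (\max_i #|L i|)%N => w le_w.
have lt_w i (l : 'I_#|L i|) : (l < w)%N.
  exact: leq_trans (ltn_ord l) (leq_trans (leq_bigmax i) le_w).
pose emb i l := Ordinal (lt_w i (enum_rank l)).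
have emb_inj i : injective (@emb i).
  by move=> l l' /(congr1 val)/= /val_inj/enum_rank_inj.
exists (fun i f => pushforward (@emb i) (v i f)) => i f g.
rewrite vK -[LHS]mul1r mulr_sumr.
rewrite -(pushforward_dot (v i f) (v i g) (fun=> 1) (@emb_inj i)).
by under eq_bigr do rewrite mul1r.
Qed.

Lemma gram_sum (R : realType) (F : Type) (I : finType) (P : pred I)
    (K : I -> F -> F -> R) :
  (forall i, is_gram (K i)) -> is_gram (fun f g => \sum_(i | P i) K i f g).
Proof.
move=> /gram_family[w /(_ w (leqnn w))[v vK]].
exists (I * 'I_w)%type, (fun f p => (P p.1)%:R * v p.1 f p.2) => f g.
rewrite big_mkcond /= (eq_bigr (fun i => \sum_j
  ((P i)%:R * v i f j) * ((P i)%:R * v i g j))) ?pair_bigA //= => i _.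
case: (P i); first by rewrite vK; under [RHS]eq_bigr do rewrite !mul1r.
by rewrite big1 // => j _; rewrite !mul0r.
Qed.

Lemma gram_mul (R : realType) (F : Type) (K H : F -> F -> R) :
  is_gram K -> is_gram H -> is_gram (fun f g => K f g * H f g).
Proof.
move=> [L [u uK]] [M [v vH]].
exists (L * M)%type, (fun f p => u f p.1 * v f p.2) => f g.
rewrite uK vH big_distrlr /= pair_bigA /=.
by apply: eq_bigr => p _; rewrite mulrACA.
Qed.

Lemma gram_diag_ge0 (R : realType) (F : Type) (K : F -> F -> R) f :
  is_gram K -> 0 <= K f f.
Proof. by move=> [L [v ->]]; apply: sumr_ge0 => l _; rewrite -expr2 sqr_ge0. Qed.

Notation query n := (n.-tuple bool * bool)%type.

Definition phase (R : realType) n (q : query n) (f : oracle n) : R :=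
  (-1) ^+ (q.2 && f q.1).

Lemma phase_sqr (R : realType) n (q : query n) (f : oracle n) :
  phase R q f * phase R q f = 1.
Proof. by rewrite -expr2 sqrr_sign. Qed.

(** Before any query the state is one unit vector common to all oracles, hence the constant 1. The
    unitary preceding a query is hidden in the free choice of the splitting [Kq]. *)
Fixpoint reach (R : realType) n (t : nat) (K : oracle n -> oracle n -> R) :
    Prop :=
  if t is t'.+1 then
    exists Kq : query n -> oracle n -> oracle n -> R,
      [/\ forall q, is_gram (Kq q),
          reach t' (fun f g => \sum_q Kq q f g) &
          forall f g, K f g = \sum_q phase R q f * phase R q g * Kq q f g]
  else forall f g, K f g = 1.

Lemma reach_eq (R : realType) n t (K K' : oracle n -> oracle n -> R) :
  (forall f g, K f g = K' f g) -> reach t K -> reach t K'.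
Proof.
case: t => [|t] KK' /=; first by move=> K1 f g; rewrite -KK'.
by move=> [Kq [gK rK eK]]; exists Kq; split=> // f g; rewrite -KK'.
Qed.

Lemma reach_gram (R : realType) n t (K : oracle n -> oracle n -> R) :
  reach t K -> is_gram K.
Proof.
case: t => [K1|t [Kq [gK _ eK]]].
  by apply: (@gram_eq R _ (fun _ _ => 1)) (gram_const _ ler01) => f g; rewrite K1.
suff: is_gram (fun f g => \sum_q phase R q f * phase R q g * Kq q f g).
  by apply: gram_eq => f g; rewrite eK.
by apply: gram_sum => q; apply: gram_mul => //; apply: (gram_rank1 (phase R q)).
Qed.

Lemma reach_diag (R : realType) n t (K : oracle n -> oracle n -> R) f :
  reach t K -> K f f = 1.
Proof.
elim: t K => [K K1|t IHt K [Kq [gK rK ->]]]; first exact: K1.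
by under eq_bigr do rewrite phase_sqr mul1r; apply: IHt rK.
Qed.

(** The whole state is put on a query whose control bit is [false], where the oracle acts
    trivially. *)
Lemma reach_wait (R : realType) n t (K : oracle n -> oracle n -> R) :
  reach t K -> reach t.+1 K.
Proof.
move=> rK; pose q0 : query n := (nseq_tuple n false, false).
pose Kq q f g := if q == q0 then K f g else 0.
have sumK f g : \sum_q Kq q f g = K f g.
  by rewrite -big_mkcond big_pred1_eq.
exists Kq; split.
- move=> q; rewrite /Kq; case: eqP => _; first exact: reach_gram rK.
  exact: gram_const.
- by apply: reach_eq rK => f g; rewrite sumK.
- move=> f g; rewrite -sumK; apply: eq_bigr => q _; rewrite /Kq.
  by case: eqP => [->|_]; rewrite ?mulr0 // /phase !expr0 !mul1r.
Qed.

Lemma reach_le (R : realType) n s t (K : oracle n -> oracle n -> R) :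
  (s <= t)%N -> reach s K -> reach t K.
Proof.
move=> /subnK <- rK; elim: (t - s)%N => // d.
by rewrite addSn; apply: reach_wait.
Qed.

(* The Hadamard product is the Gram matrix of the tensor product: the second
   algorithm is run on a fresh register, controlled by the outcome [a]. *)
Lemma reach_seq (R : realType) n s t (A : finType)
    (K H : A -> oracle n -> oracle n -> R) :
  (forall a, is_gram (K a)) -> reach s (fun f g => \sum_a K a f g) ->
  (forall a, reach t (H a)) ->
  reach (s + t) (fun f g => \sum_a K a f g * H a f g).
Proof.
move=> gK rK; elim: t H => [H H1|t IHt H rH].
  rewrite addn0; apply: reach_eq rK => f g.
  by apply: eq_bigr => a _; rewrite H1 mulr1.
have {rH} [Hq HqP] := choice rH.
rewrite addnS; exists (fun q f g => \sum_a K a f g * Hq a q f g); split.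
- move=> q; apply: gram_sum => a; apply: gram_mul => //.
  by case: (HqP a).
- have rH a : reach t (fun f g => \sum_q Hq a q f g) by case: (HqP a).
  have := IHt _ rH.
  apply: reach_eq => f g; rewrite exchange_big; apply: eq_bigr => a _.
  by rewrite mulr_sumr.
- move=> f g; under eq_bigr => a _.
    by case: (HqP a) => _ _ ->; rewrite mulr_sumr; over.
  rewrite exchange_big; apply: eq_bigr => q _.
  by rewrite mulr_sumr; apply: eq_bigr => a _; rewrite mulrCA.
Qed.

(** [K a] is the Gram matrix of the unnormalised states projected on outcome [a], so [K a f f] is
    the probability of [a] on [f]. *)
Definition measured (R : realType) n (t : nat) (A : finType)
    (K : A -> oracle n -> oracle n -> R) : Prop :=
  (forall a, is_gram (K a)) /\ reach t (fun f g => \sum_a K a f g).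

Lemma measured_pair (R : realType) n s t (A B : finType)
    (K : A -> oracle n -> oracle n -> R)
    (H : A -> B -> oracle n -> oracle n -> R) :
  measured s K -> (forall a, measured t (H a)) ->
  measured (s + t) (fun ab f g => K ab.1 f g * H ab.1 ab.2 f g).
Proof.
move=> [gK rK] mH; split=> [[a b]|].
  by apply: gram_mul => //; case: (mH a).
have rH a : reach t (fun f g => \sum_b H a b f g) by case: (mH a).
have := reach_seq gK rK rH.
apply: reach_eq => f g; rewrite -(pair_bigA _ (fun a b => K a f g * H a b f g)) /=.
by apply: eq_bigr => a _; rewrite mulr_sumr.
Qed.

Lemma measured_map (R : realType) n t (A B : finType) (h : A -> B)
    (K : A -> oracle n -> oracle n -> R) :
  measured t K ->
  measured t (fun b f g => \sum_(a | h a == b) K a f g).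
Proof.
move=> [gK rK]; split=> [b|]; first exact: gram_sum.
apply: reach_eq rK => f g.
by rewrite (partition_big h predT).
Qed.

Lemma measured_bind (R : realType) n s t (A B : finType)
    (K : A -> oracle n -> oracle n -> R)
    (H : A -> B -> oracle n -> oracle n -> R) :
  measured s K -> (forall a, measured t (H a)) ->
  measured (s + t) (fun b f g => \sum_a K a f g * H a b f g).
Proof.
move=> mK mH; have [gP rP] := measured_map snd (measured_pair mK mH).
have bindE b f g : \sum_(ab : A * B | ab.2 == b) K ab.1 f g * H ab.1 ab.2 f g =
    \sum_a K a f g * H a b f g.
  rewrite (eq_bigl (fun ab : A * B => (xpredT ab.1) && (ab.2 == b))) //.
  rewrite -(pair_big xpredT (fun b' => b' == b) (fun a b' => K a f g * H a b' f g)) /=.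
  by apply: eq_bigr => a _; rewrite big_pred1_eq.
split=> [b|]; first by apply: gram_eq (gP b) => f g; apply: bindE.
by apply: reach_eq rP => f g; apply: eq_bigr => b _; apply: bindE.
Qed.

Definition prob (R : realType) n (A : finType)
    (K : A -> oracle n -> oracle n -> R) (f : oracle n) (P : pred A) : R :=
  \sum_(a | P a) K a f f.

Lemma prob_ge0 (R : realType) n t (A : finType)
    (K : A -> oracle n -> oracle n -> R) f (P : pred A) :
  measured t K -> 0 <= prob K f P.
Proof. by move=> [gK _]; apply: sumr_ge0 => a _; apply: gram_diag_ge0. Qed.

Lemma prob_predC (R : realType) n t (A : finType)
    (K : A -> oracle n -> oracle n -> R) f (P : pred A) :
  measured t K -> prob K f P = 1 - prob K f (predC P).
Proof.
move=> [_ /(reach_diag f)]; rewrite /prob (bigID P) /= => <-.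
by rewrite addrK.
Qed.

(** * From Gram matrices to gates *)

Definition dot (R : comPzRingType) d (x y : 'cV[R]_d) : R := (x^T *m y) 0 0.

Lemma dotE (R : comPzRingType) d (x y : 'cV[R]_d) :
  dot x y = \sum_k x k 0 * y k 0.
Proof. by rewrite /dot mxE; apply: eq_bigr => k _; rewrite mxE. Qed.

Lemma dot_isometry (R : comPzRingType) d (V : 'M[R]_d) (x y : 'cV[R]_d) :
  V^T *m V = 1%:M -> dot (V *m x) (V *m y) = dot x y.
Proof. by move=> VV; rewrite /dot trmx_mul mulmxA -(mulmxA _ _ V) VV mulmx1. Qed.

Definition householder (R : fieldType) d (z : 'cV[R]_d) : 'M[R]_d :=
  1%:M - (2 / dot z z) *: (z *m z^T).

Lemma householderE (R : fieldType) d (z x : 'cV[R]_d) :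
  householder z *m x = x - (2 / dot z z * dot z x) *: z.
Proof.
rewrite mulmxBl mul1mx -scalemxAl -mulmxA [z^T *m x]mx11_scalar.
by rewrite mul_mx_scalar scalerA.
Qed.

Lemma trmx_householder (R : fieldType) d (z : 'cV[R]_d) :
  (householder z)^T = householder z.
Proof. by rewrite /householder raddfB /= linearZ /= trmx1 trmx_mul trmxK. Qed.

Lemma dot_eq0 (R : realFieldType) d (z : 'cV[R]_d) : dot z z = 0 -> z = 0.
Proof.
rewrite dotE => /eqP; rewrite psumr_eq0 => [/allP z0|k _]; last first.
  by rewrite -expr2 sqr_ge0.
apply/colP => k; rewrite mxE; apply/eqP.
by have := z0 k (mem_index_enum k); rewrite /= mulf_eq0 orbb.
Qed.

Lemma householder_orthogonal (R : realFieldType) d (z : 'cV[R]_d) :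
  (householder z)^T *m householder z = 1%:M.
Proof.
rewrite trmx_householder; have [/dot_eq0 ->|z0] := eqVneq (dot z z) 0.
  by rewrite /householder mul0mx scaler0 subr0 mulmx1.
have Hz : householder z *m z = - z.
  by rewrite householderE divfK // scaler_nat mulr2n opprD addrA subrr sub0r.
rewrite {2}/householder mulmxBr mulmx1 -scalemxAr mulmxA Hz mulNmx scalerN opprK.
by rewrite subrK.
Qed.

(* Householder reflections: once [V] is correct on a tail of the list,
   reflecting [V s_i] onto [t_i] fixes every vector already matched. *)
Lemma isometry_extension (R : realFieldType) d (I : eqType) (r : seq I)
    (s t : I -> 'cV[R]_d) :
  (forall i j, dot (s i) (s j) = dot (t i) (t j)) ->
  exists V : 'M[R]_d, V^T *m V = 1%:M /\ {in r, forall i, V *m s i = t i}.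
Proof.
move=> st; elim: r => [|i r [V [VV Vr]]].
  by exists 1%:M; rewrite trmx1 mulmx1.
have Vdot x y : dot (V *m x) (V *m y) = dot x y by apply: dot_isometry.
pose z := V *m s i - t i.
have dotB x : dot z x = dot (V *m s i) x - dot (t i) x.
  by rewrite /dot /z linearB /= mulmxBl !mxE.
have dotC (x y : 'cV[R]_d) : dot x y = dot y x.
  by rewrite !dotE; apply: eq_bigr => k _; rewrite mulrC.
exists (householder z *m V); split.
  by rewrite trmx_mul mulmxA -(mulmxA _ _ (householder z))
    householder_orthogonal mulmx1.
have zi : householder z *m (V *m s i) = t i.
  (* Both vectors have the same norm, so the coefficient of the reflection is 1 and [V *m s i] goes
     to [V *m s i - z = t i]. If [z = 0] they already agree, and division by zero gives the
     coefficient 0. *)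
  have zz : dot z z = 2 * dot z (V *m s i).
    rewrite dotB (dotC (V *m s i) z) (dotC (t i) z) !dotB.
    by rewrite (dotC (V *m s i) (t i)) Vdot st; ring.
  rewrite householderE; have [z0|z0] := eqVneq (dot z z) 0.
    rewrite z0 invr0 mulr0 mul0r scale0r subr0.
    by move/dot_eq0/eqP: z0; rewrite subr_eq0 => /eqP.
  rewrite (_ : _ * _ = 1) ?scale1r /z ?subKr //.
  by move: z0; rewrite zz => z0; field; move: z0; rewrite mulf_eq0 negb_or => /andP[].
move=> j; rewrite inE -mulmxA => /orP[/eqP -> //|jr].
(* Here [V *m s j = t j], and both inner products in [dotB] equal [dot (t i) (t j)]; thus [z] is
   orthogonal to it. *)
by rewrite householderE (dotB (V *m s j)) Vdot st Vr // subrr mulr0 scale0r subr0.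
Qed.

(** Real form of [oracle_mx]: all gates are built over the reals and mapped to the complex numbers
    only at the end. *)
Definition phase_mx (R : pzRingType) n w (f : oracle n) : 'M[R]_(hdim n w) :=
  diag_mx (\row_k let: (x, b, _) := enum_val k in (-1) ^+ (b && f x)).

Fixpoint gate_state (R : pzRingType) n w (U : nat -> 'M[R]_(hdim n w))
    (x : 'cV[R]_(hdim n w)) (f : oracle n) (j : nat) : 'cV[R]_(hdim n w) :=
  if j is j'.+1 then U j *m (phase_mx R w f *m gate_state U x f j')
  else U 0%N *m x.

Lemma eq_gate_state (R : pzRingType) n w (U U' : nat -> 'M[R]_(hdim n w)) x f j :
  (forall i, (i <= j)%N -> U i = U' i) -> gate_state U x f j = gate_state U' x f j.
Proof.
elim: j => [|j IHj] UU /=; first by rewrite UU.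
by rewrite UU // IHj // => i le_i; rewrite UU // leqW.
Qed.

Definition replace_gate (R : pzRingType) d (U : nat -> 'M[R]_d) t (V : 'M[R]_d) :
    nat -> 'M[R]_d :=
  fun j => if j == t then V *m U t else U j.

Lemma replace_gate_state (R : pzRingType) n w (U : nat -> 'M[R]_(hdim n w)) x f t V :
  gate_state (replace_gate U t V) x f t = V *m gate_state U x f t.
Proof.
case: t => [|t] /=; rewrite /replace_gate eqxx ?mulmxA //.
congr (_ *m _ *m _); apply: eq_gate_state => i le_i.
by rewrite ltn_eqF // ltnS.
Qed.

(** The states before the last query have the same Gram matrix as the vectors [T f], whose block at
    query content [q] realises [Kq q]. An isometry therefore carries one family to the other; it is
    absorbed into gate [t], and the gate after the query is the identity. *)
Lemma reach_gates (R : realType) n t (K : oracle n -> oracle n -> R) :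
  reach t K ->
  exists d : nat, forall w : nat, (d <= w)%N ->
    exists (x : 'cV[R]_(hdim n w)) (U : nat -> 'M[R]_(hdim n w)),
      [/\ dot x x = 1, forall j, (U j)^T *m U j = 1%:M &
        forall f g, dot (gate_state U x f t) (gate_state U x g t) = K f g].
Proof.
elim: t K => [|t IHt] K.
  move=> K1; exists 1%N => w w1.
  pose k : 'I_(hdim n w) := enum_rank (nseq_tuple n false, false, Ordinal w1).
  have kk : dot (delta_mx k 0) (delta_mx k 0) = 1 :> R.
    rewrite dotE (bigD1 k) //= big1 ?addr0 => [|j /negPf jk]; rewrite !mxE ?eqxx ?mulr1 //.
    by rewrite jk mul0r.
  exists (delta_mx k 0), (fun=> 1%:M); split=> // [j|f g].
    by rewrite trmx1 mulmx1.
  by rewrite /= mul1mx kk K1.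
move=> [Kq [gK rK eK]].
have [d1 {}IHt] := IHt _ rK; have [d2 dK] := gram_family gK.
exists (maxn d1 d2) => w; rewrite geq_max => /andP[/IHt{IHt}[x [U [xx UU dotU]]]].
move=> /dK[v vK].
pose T f : 'cV[R]_(hdim n w) :=
  \col_k let: (q, i) := enum_val k : basis_label n w in v q f i.
have dotT f g : dot (T f) (T g) = \sum_q Kq q f g.
  rewrite dotE (reindex _ (onW_bij _ (@enum_rank_bij _))) /=.
  rewrite (eq_bigr (fun p => v p.1 f p.2 * v p.1 g p.2)) => [|[q i] _].
    rewrite -(pair_bigA _ (fun q i => v q f i * v q g i)) /=.
    by apply: eq_bigr => q _; rewrite vK.
  by rewrite !mxE enum_rankK.
have [V [VV VT]] := isometry_extension (enum {: oracle n})
  (fun f g => etrans (dotU f g) (esym (dotT f g))).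
exists x, (fun j => if j == t.+1 then 1%:M else replace_gate U t V j).
split=> // [j|f g].
  rewrite /replace_gate; case: eqP => _; first by rewrite trmx1 mulmx1.
  case: eqP => // _; rewrite trmx_mul mulmxA -(mulmxA _ _ V) VV mulmx1.
  exact: UU.
rewrite /= eqxx !mul1mx.
have stateT h : gate_state (fun j => if j == t.+1 then 1%:M
    else replace_gate U t V j) x h t = T h.
  rewrite (@eq_gate_state _ _ _ _ (replace_gate U t V)) => [|i le_i].
    by rewrite replace_gate_state VT ?mem_enum.
  by rewrite ltn_eqF // ltnS.
rewrite !stateT eK dotE (reindex _ (onW_bij _ (@enum_rank_bij _))) /=.
rewrite (eq_bigr (fun p => phase R p.1 f * phase R p.1 g *
  (v p.1 f p.2 * v p.1 g p.2))) => [|[[y b] i] _].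
  rewrite -(pair_bigA _ (fun q i => phase R q f * phase R q g *
    (v q f i * v q g i))) /=.
  by apply: eq_bigr => q _; rewrite vK mulr_sumr.
rewrite /phase_mx !mul_diag_mx !mxE !enum_rankK /phase /=.
by rewrite mulrACA.
Qed.

Lemma conj_map_real_complex (R : realType) m d (M : 'M[R]_(m, d)) :
  (map_mx (real_complex R) M)^t* = map_mx (real_complex R) M^T.
Proof. by apply/matrixP => i j; rewrite !mxE; apply: conjc_real. Qed.

Lemma oracle_mx_real (R : realType) n w (f : oracle n) :
  oracle_mx R w f = map_mx (real_complex R) (phase_mx R w f).
Proof.
rewrite /oracle_mx /phase_mx map_diag_mx; congr diag_mx; apply/rowP => k.
by rewrite !mxE; case: (enum_val k) => [[x b] i]; rewrite rmorphXn rmorphN1.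
Qed.

(** A last rotation sends each final state to the concatenation, over the outcomes [o], of the
    vectors realising [K o]; the measurement reads off the block. *)
Lemma measured_algorithm (R : realType) n t
    (K : oracle n -> oracle n -> oracle n -> R) :
  measured t K ->
  exists A : query_algorithm R n t, forall f g, output_prob A f g = K g f f.
Proof.
move=> [gK rK]; have [d1 gates] := reach_gates rK.
have [d2 /(_ d2 (leqnn d2))[v vK]] := gram_family gK.
pose L : finType := (oracle n * 'I_d2)%type.
pose w := maxn d1 #|L|.
have [x [U [xx UU dotU]]] := gates w (leq_maxl _ _).
pose emb (l : L) : 'I_(hdim n w) := enum_rank
  (nseq_tuple n false, false, widen_ord (leq_maxr d1 #|L|) (enum_rank l)).
have emb_inj : injective emb.
  by move=> l l' /enum_rank_inj[]/val_inj/enum_rank_inj.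
pose u f (l : L) := v l.1 f l.2.
pose T f : 'cV[R]_(hdim n w) := \col_k pushforward emb (u f) k.
have dotT f g : dot (T f) (T g) = \sum_o K o f g.
  rewrite dotE (eq_bigr (fun k => 1 * (pushforward emb (u f) k *
    pushforward emb (u g) k))) => [|k _]; last by rewrite !mxE mul1r.
  rewrite (pushforward_dot (u f) (u g) (fun=> 1) emb_inj).
  rewrite -(pair_bigA _ (fun o i => 1 * (v o f i * v o g i))) /=.
  by apply: eq_bigr => o _; rewrite vK; apply: eq_bigr => i _; rewrite mul1r.
have [V [VV VT]] := isometry_extension (enum {: oracle n})
  (fun f g => etrans (dotU f g) (esym (dotT f g))).
(* Basis labels outside the image of [emb] get a default outcome: [T f] vanishes there, but the
   projectors must sum to the identity. *)
pose out k : oracle n :=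
  if [pick l | emb l == k] is Some l then l.1 else [ffun=> false].
have out_emb l : out (emb l) = l.1.
  rewrite /out; case: pickP => [l' /eqP/emb_inj -> //|/(_ l)].
  by rewrite eqxx.
pose proj o : 'M[R]_(hdim n w) := diag_mx (\row_k (out k == o)%:R).
pose W := replace_gate U t V.
have WW j : (W j)^T *m W j = 1%:M.
  rewrite /W /replace_gate; case: eqP => // _.
  by rewrite trmx_mul mulmxA -(mulmxA _ _ V) VV mulmx1 UU.
pose C := real_complex R.
have init_unit : (map_mx C x)^t* *m map_mx C x = 1%:M.
  by rewrite conj_map_real_complex -map_mxM [_ *m _]mx11_scalar -/(dot x x) xx map_mx1.
have W_unitary j : (j <= t)%N -> map_mx C (W j) \is unitarymx.
  move=> _; apply/unitarymxP; rewrite conj_map_real_complex -map_mxM.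
  by rewrite (mulmx1C (WW j)) map_mx1.
have meas : projective_measurement (fun o => map_mx C (proj o)).
  split=> [o|o o'|].
  - by rewrite conj_map_real_complex tr_diag_mx.
  - rewrite -map_mxM mulmx_diag; case: eqP => [<-|/eqP oo'].
      congr map_mx; congr diag_mx; apply/rowP => k; rewrite !mxE.
      by case: eqP; rewrite ?mulr1 ?mulr0.
    rewrite (_ : diag_mx _ = 0) ?map_mx0 //; apply/matrixP => i j; rewrite !mxE.
    case: (out i =P o) => [->|_]; last by rewrite mul0r mul0rn.
    by rewrite (negPf oo') mulr0 mul0rn.
  - rewrite -map_mx_sum (_ : \sum_o proj o = 1%:M) ?map_mx1 //.
    apply/matrixP => i j; rewrite summxE (bigD1 (out i)) //= big1.
      by rewrite !mxE eqxx addr0.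
    by move=> o /negPf; rewrite eq_sym !mxE => ->; rewrite mul0rn.
pose A := QueryAlgorithm init_unit W_unitary meas.
have stateA f j : alg_state A f j = map_mx C (gate_state W x f j).
  elim: j => [|j /= ->]; first by rewrite /= map_mxM.
  by rewrite oracle_mx_real !map_mxM.
exists A => f g; rewrite /output_prob stateA replace_gate_state VT ?mem_enum //=.
rewrite conj_map_real_complex -!map_mxM mxE /= -mulmxA mul_diag_mx mxE.
rewrite (eq_bigr (fun k => (out k == g)%:R * (pushforward emb (u f) k *
    pushforward emb (u f) k))) => [|k _]; last by rewrite !mxE mulrCA.
rewrite (pushforward_dot (u f) (u f) (fun k => (out k == g)%:R) emb_inj).
under eq_bigr do rewrite out_emb.
rewrite -(pair_bigA _ (fun o i => (o == g)%:R * (v o f i * v o f i))) /=.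
rewrite (bigD1 g) //= [X in _ + X]big1 ?addr0 => [|o og]; last first.
  by rewrite big1 // => i _; rewrite (negPf og) mul0r.
by rewrite vK; apply: eq_bigr => i _; rewrite eqxx mul1r.
Qed.

(** * Grover search with a random number of iterations *)

Lemma sum_eqb (R : pzRingType) (A : finType) (a : A) :
  \sum_(b : A) (a == b)%:R = 1 :> R.
Proof.
rewrite (bigD1 a) //= eqxx big1 ?addr0 // => b ba.
by rewrite eq_sym (negPf ba).
Qed.

(** The control bit is put in uniform superposition at column [x]; the phase query yields the Gram
    matrix (1 + (-1)^(f(x) + g(x))) / 2, the indicator of f(x) = g(x), so the bit can be read with
    certainty. *)
Lemma measured_classical (R : realType) n (x : n.-tuple bool) :
  measured 1 (fun b (f g : oracle n) => (f x == b)%:R * (g x == b)%:R : R).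
Proof.
split=> [b|]; first exact: (gram_rank1 (fun f : oracle n => (f x == b)%:R : R)).
exists (fun q _ _ => (x == q.1)%:R / 2); split=> [q|f g|f g].
- by apply: gram_const; rewrite divr_ge0.
- rewrite -(pair_bigA _ (fun y (_ : bool) => (x == y)%:R / 2)) /=.
  under eq_bigr do rewrite big_bool /= -splitr.
  exact: sum_eqb.
- rewrite -(pair_bigA _ (fun y (b : bool) => phase R (y, b) f *
    phase R (y, b) g * ((x == y)%:R / 2))) /= (bigD1 x) //=.
  rewrite [X in _ = _ + X]big1 => [|y yx]; last first.
    by rewrite big1 // => b _; rewrite eq_sym (negPf yx) mul0r mulr0.
  rewrite !big_bool /= eqxx /phase /=.
  by case: (f x); case: (g x); rewrite /=; field.
Qed.

Lemma measured_uniform (R : realType) n (J : nat) : (0 < J)%N ->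
  measured 0 (fun (_ : 'I_J) (_ _ : oracle n) => J%:R^-1 : R).
Proof.
move=> J0; split=> [j|f g]; first by apply: gram_const; rewrite invr_ge0.
by rewrite sumr_const card_ord -[LHS]mulr_natl mulfV // pnatr_eq0 -lt0n.
Qed.

Lemma reach_query (R : realType) n t (L : finType) (col : L -> query n)
    (v : oracle n -> L -> R) :
  reach t (fun f g => \sum_l v f l * v g l) ->
  reach t.+1 (fun f g => \sum_l (phase R (col l) f * v f l) *
                                (phase R (col l) g * v g l)).
Proof.
move=> rK; exists (fun q f g => \sum_(l | col l == q) v f l * v g l); split.
- by move=> q; apply: gram_sum => l; apply: (gram_rank1 (v^~ l)).
- by apply: reach_eq rK => f g; rewrite (partition_big col predT).
- move=> f g; rewrite (partition_big col predT) //; apply: eq_bigr => q _.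
  by rewrite mulr_sumr; apply: eq_bigr => l /eqP <-; rewrite mulrACA.
Qed.

(** Grover's diffusion operator: twice the projection on the uniform vector, minus the identity. *)
Definition mean_reflection (R : fieldType) (L : finType) (v : L -> R) (l : L) : R :=
  2 / #|L|%:R * (\sum_k v k) - v l.

Lemma mean_reflection_dot (R : realFieldType) (L : finType) (u v : L -> R) :
  (0 < #|L|)%N ->
  \sum_l mean_reflection u l * mean_reflection v l = \sum_l u l * v l.
Proof.
move=> L0; have D0 : #|L|%:R != 0 :> R by rewrite pnatr_eq0 -lt0n.
rewrite /mean_reflection; set U := \sum_k u k; set V := \sum_k v k.
set c := 2 / _.
rewrite (eq_bigr (fun l => c * U * (c * V) + - (c * U) * v l +
  - (c * V) * u l + u l * v l)) => [|l _]; last by ring.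
rewrite !big_split /= -!mulr_sumr -/U -/V sumr_const -[_ *+ _]mulr_natl /c.
by field.
Qed.

Section Grover.

Variables (R : realType) (n : nat) (L : finType) (col : L -> query n).
Variable m : oracle n.
Hypothesis L0 : (0 < #|L|)%N.

Definition marked (f : oracle n) (l : L) : bool :=
  (col l).2 && (f (col l).1 != m (col l).1).

Definition flip_marked (f : oracle n) (v : L -> R) (l : L) : R :=
  (-1) ^+ marked f l * v l.

Fixpoint grover_state (f : oracle n) (j : nat) : L -> R :=
  if j is j'.+1 then mean_reflection (flip_marked f (grover_state f j'))
  else fun=> Num.sqrt (#|L|%:R^-1).

Lemma reach_grover j :
  reach j (fun f g => \sum_l grover_state f j l * grover_state g j l).
Proof.
elim: j => [|j IHj] /=.
  move=> f g; rewrite -expr2 sqr_sqrtr ?invr_ge0 // sumr_const -[LHS]mulr_natl mulfV //.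
  by rewrite pnatr_eq0 -lt0n.
apply: reach_eq (reach_query col IHj) => f g /=.
rewrite mean_reflection_dot //; apply: eq_bigr => l _.
(* Marking relative to [m] differs from the query phase by a sign depending on [m] alone, which
   cancels in the Gram matrix. *)
rewrite /flip_marked /marked /phase.
by case: (col l) => x [] /=; case: (f x); case: (g x); case: (m x); rewrite /=; ring.
Qed.

(** The number of iterations is uniform below [J], since the best fixed number would depend on how
    many labels are marked, which is unknown. *)
Lemma measured_grover J : (0 < J)%N ->
  measured J (fun l f g =>
    \sum_(j < J) J%:R^-1 * (grover_state f j l * grover_state g j l)).
Proof.
move=> J0; apply: (measured_bind (measured_uniform R n J0)) => j; split.
  by move=> l; apply: (gram_rank1 (fun f => grover_state f j l)).
by apply: reach_le (reach_grover j); apply: ltnW.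
Qed.

(** Amplitudes of a single marked and a single unmarked label after [j] iterations, when a fraction
    [mu] is marked; each class keeps a constant amplitude. *)
Fixpoint grover_amp (mu a0 : R) (j : nat) : R * R :=
  if j is j'.+1 then
    let: (a, b) := grover_amp mu a0 j' in
    ((1 - 2 * mu) * a + 2 * (1 - mu) * b, (1 - 2 * mu) * b - 2 * mu * a)
  else (a0, a0).

Definition marked_frac (f : oracle n) : R := #|marked f|%:R / #|L|%:R.

Lemma grover_stateE f j l :
  let: (a, b) := grover_amp (marked_frac f) (Num.sqrt (#|L|%:R^-1)) j in
  grover_state f j l = if marked f l then a else b.
Proof.
have D0 : #|L|%:R != 0 :> R by rewrite pnatr_eq0 -lt0n.
elim: j l => [|j IHj] l /=; first by case: ifP.
case: grover_amp IHj => a b IHj.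
have sumE : \sum_k flip_marked f (grover_state f j) k =
    #|L|%:R * ((1 - marked_frac f) * b - marked_frac f * a).
  rewrite (bigID (marked f)) /= (eq_bigr (fun=> - a)) => [|k mk]; last first.
    by rewrite /flip_marked IHj mk mulN1r.
  rewrite [X in _ + X](eq_bigr (fun=> b)) => [|k /negPf mk]; last first.
    by rewrite /flip_marked IHj mk mul1r.
  rewrite !sumr_const -(mulr_natl (- a)) -(mulr_natl b).
  have -> : #|[pred k | ~~ marked f k]|%:R = #|L|%:R - #|marked f|%:R :> R.
    by rewrite -(cardC (marked f)) natrD addrC addKr.
  by rewrite /marked_frac; field.
rewrite /mean_reflection sumE /flip_marked IHj.
by case: (marked f l); rewrite /=; field.
Qed.

Lemma grover_amp_norm mu D a0 j :
  D * a0 ^+ 2 = 1 ->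
  let: (a, b) := grover_amp mu a0 j in
  D * (mu * a ^+ 2 + (1 - mu) * b ^+ 2) = 1.
Proof.
move=> a01; elim: j => [|j IHj] /=; first by rewrite -[RHS]a01; ring.
by case: grover_amp IHj => a b IHj; rewrite -[RHS]IHj; ring.
Qed.

(* With mu = sin^2 theta, the j-th term is cos((4 j + 2) theta); the closed
   form is sin(4 J theta) / (2 sin(2 theta)) made polynomial. *)
Lemma grover_amp_sum mu a0 J :
  \sum_(j < J) (let: (a, b) := grover_amp mu a0 j in
                (1 - mu) * b ^+ 2 - mu * a ^+ 2) =
  let: (a, b) := grover_amp mu a0 J in
  (a * b * (1 - 2 * mu) - ((1 - mu) * b ^+ 2 - mu * a ^+ 2)) / 2.
Proof.
elim: J => [|J IHJ]; first by rewrite big_ord0 /=; field.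
by rewrite big_ord_recr /= IHJ; case: grover_amp => a b; field.
Qed.

Lemma grover_success f J :
  (0 < #|marked f|)%N -> (2 * #|marked f| <= #|L|)%N ->
  (25 * #|L| <= 4 * J ^ 2)%N ->
  1 / 4 <= prob (fun l f g =>
    \sum_(j < J) J%:R^-1 * (grover_state f j l * grover_state g j l))
    f (marked f).
Proof.
set k := #|marked f| => k0 kD DJ.
have D0 : 0 < #|L|%:R :> R by rewrite ltr0n.
have Dn0 := lt0r_neq0 D0.
set D : R := #|L|%:R in D0 Dn0.
have J0 : 0 < J%:R :> R by rewrite ltr0n; move: DJ; case: (J) => //; lia.
have kD' : 2 * k%:R <= D by rewrite -natrM ler_nat.
have DJ' : 25 * D <= 4 * J%:R ^+ 2 by rewrite -natrX -!natrM ler_nat.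
have k1 : 1 <= k%:R :> R by rewrite ler1n.
set mu := marked_frac f; set a0 := Num.sqrt (D^-1).
have Dmu : D * mu = k%:R by rewrite /mu /marked_frac -/D -/k; field.
have a01 : D * a0 ^+ 2 = 1 by rewrite sqr_sqrtr ?invr_ge0 ?ltW // mulfV.
pose amp := grover_amp mu a0.
have probE : prob (fun l f g => \sum_(j < J) J%:R^-1 *
    (grover_state f j l * grover_state g j l)) f (marked f) =
    J%:R^-1 * \sum_(j < J) D * (mu * (amp j).1 ^+ 2).
  rewrite /prob exchange_big /= mulr_sumr; apply: eq_bigr => j _.
  rewrite -mulr_sumr; congr (_ * _).
  rewrite (eq_bigr (fun=> (amp j).1 ^+ 2)) => [|l ml]; last first.
    by have := grover_stateE f j l; rewrite ml /amp; case: grover_amp => a b ->.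
  by rewrite sumr_const -[LHS]mulr_natl mulrA Dmu.
(* The marked and unmarked masses sum to 1, so the marked one is half of 1 minus their difference,
   and [grover_amp_sum] evaluates the summed differences. *)
have sumE : \sum_(j < J) D * (mu * (amp j).1 ^+ 2) = (J%:R - D *
    \sum_(j < J) ((1 - mu) * (amp j).2 ^+ 2 - mu * (amp j).1 ^+ 2)) / 2.
  have -> : J%:R = \sum_(j < J) (1 : R) by rewrite sumr_const card_ord.
  rewrite mulr_sumr -sumrB mulr_suml; apply: eq_bigr => j _.
  have := grover_amp_norm mu j a01; rewrite /amp; case: grover_amp => a b nab /=.
  by rewrite -[X in (X - _) / 2]nab; field.
rewrite probE sumE.
have := grover_amp_sum mu a0 J.
rewrite (eq_bigr (fun j : 'I_J =>
  (1 - mu) * (amp j).2 ^+ 2 - mu * (amp j).1 ^+ 2)) => [->|j _]; last by rewrite /amp; case: grover_amp.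
have := grover_amp_norm mu J a01; case: (grover_amp mu a0 J) => a b nab.
have na : k%:R * a ^+ 2 <= 1.
  rewrite -[leRHS]nab mulrDr (mulrA D mu) (mulrA D (1 - mu)) Dmu.
  rewrite lerDl mulr_ge0 ?sqr_ge0 //.
  by rewrite mulrBr mulr1 Dmu; lra.
have nb : (D - k%:R) * b ^+ 2 <= 1.
  rewrite -[leRHS]nab mulrDr (mulrA D mu) (mulrA D (1 - mu)) Dmu.
  by rewrite mulrBr mulr1 Dmu lerDr mulr_ge0 ?sqr_ge0.
have a2 : 0 <= a ^+ 2 by apply: sqr_ge0.
have b2 : 0 <= b ^+ 2 by apply: sqr_ge0.
(* This uses [k >= 1]; the next bound uses [2 k <= D], which makes [D - k] at least [D / 2]. *)
have a1 : a ^+ 2 <= 1 by nra.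
have Db : D * b ^+ 2 <= 2 by nra.
(* The left side is at most 2 D, hence at most (8/25) J^2 by [DJ'], which is below (9/25) J^2. *)
have x2 : (D * (a * b)) ^+ 2 <= (6 / 10 * J%:R) ^+ 2.
  have -> : (D * (a * b)) ^+ 2 = a ^+ 2 * (D * (D * b ^+ 2)) by ring.
  have y : D * (D * b ^+ 2) <= D * 2 by rewrite ler_pM2l.
  have y0 : 0 <= D * (D * b ^+ 2) by apply: (mulr_ge0 (ltW D0)); apply: (mulr_ge0 (ltW D0)).
  have := ler_pM a2 y0 a1 y; nra.
have x1 : `|D * (a * b)| <= 6 / 10 * J%:R.
  by rewrite -(@ler_pXn2r _ 2) ?nnegrE ?real_normK ?num_real //; nra.
have mu0 : 0 <= mu by rewrite -(pmulr_rge0 _ D0) Dmu.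
have mu1 : mu <= 1 / 2 by rewrite -(ler_pM2l D0) Dmu; lra.
have x3 : D * (a * b) * (1 - 2 * mu) <= 6 / 10 * J%:R.
  apply: le_trans (ler_norm _) _; rewrite normrM.
  apply: le_trans x1; rewrite ler_piMr // ler_norml; lra.
have J3 : 1 <= 4 / 10 * J%:R :> R.
  by rewrite -(@ler_pXn2r _ 2) ?nnegrE //; nra.
(* The summed differences times D are at most (0.6 J + 1) / 2, hence at most J / 2 by [J3]; this
   leaves a marked mass of at least J / 4. *)
rewrite -(ler_pM2l J0) mulVKf ?lt0r_neq0 //.
have -> : D * ((a * b * (1 - 2 * mu) - ((1 - mu) * b ^+ 2 - mu * a ^+ 2)) / 2) =
  (D * (a * b) * (1 - 2 * mu) - ((D - D * mu) * b ^+ 2 - D * mu * a ^+ 2)) / 2.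
  by ring.
rewrite Dmu; nra.
Qed.

End Grover.

(** * Halving the set of candidates *)

(** Remove one element [g] and separate the rest by [s]. At most one remaining [h] agrees with [g]
    on [s], and one more column tells them apart. *)
Lemma separating_columns n (T : {set oracle n}) :
  exists s : seq (n.-tuple bool), (size s <= #|T|)%N /\
    {in T &, forall g h : oracle n, {in s, g =1 h} -> g = h}.
Proof.
move: {2}#|T| (erefl #|T|) => k; elim: k T => [|k IHk] T.
  by move/cards0_eq->; exists [::]; split=> // g h; rewrite inE.
move=> Tk; have /card_gt0P[g gT] : (0 < #|T|)%N by rewrite Tk.
have Tgk : #|T :\ g| = k by move: (cardsD1 g T); rewrite gT Tk => -[].
have [s [sT sep]] := IHk _ Tgk; rewrite Tgk in sT.
have sepT u h : u \in T -> h \in T -> u != g -> h != g -> {in s, u =1 h} -> u = h.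
  by move=> uT hT ug hg; apply: sep; rewrite in_setD1 ?ug ?hg.
have [/exists_inP[h hT /andP[hg /allP gh]]|/exists_inPn none] :=
    boolP [exists h in T, (h != g) && all (fun x => g x == h x) s].
  have [x gx] : exists x, g x != h x.
    apply/existsP; apply: contraNT hg => /existsPn gh'; apply/eqP/ffunP => x.
    by apply/eqP; rewrite eq_sym; move: (gh' x); rewrite negbK.
  have only u : u \in T -> {in x :: s, g =1 u} -> u = g.
    move=> uT gu; apply/eqP/contraT => ug.
    have uh : u = h.
      apply: sepT => // y ys; rewrite -(eqP (gh y ys)) gu //.
      by rewrite inE ys orbT.
    by move: gx; rewrite gu ?inE ?eqxx // uh eqxx.
  exists (x :: s); rewrite Tk; split=> // u v uT vT uv.
  have [ug|ug] := eqVneq u g; first by rewrite [v]only // -ug.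
  have [vg|vg] := eqVneq v g.
    by rewrite [u]only // => y ys; rewrite -vg -uv.
  by apply: sepT => // y ys; rewrite uv // inE ys orbT.
have only u : u \in T -> {in s, g =1 u} -> u = g.
  move=> uT gu; apply/eqP/contraT => ug; have := none u uT.
  by rewrite ug /= => /allPn[x xs]; rewrite gu // eqxx.
exists s; rewrite Tk; split=> [|u v uT vT uv]; first exact: leqW.
have [ug|ug] := eqVneq u g; first by rewrite [v]only // -ug.
have [vg|vg] := eqVneq v g.
  by rewrite [u]only // => y ys; rewrite -vg -uv.
exact: sepT.
Qed.

Definition separators n (T : {set oracle n}) : seq (n.-tuple bool) :=
  projT1 (cid (separating_columns T)).

Lemma size_separators n (T : {set oracle n}) : (size (separators T) <= #|T|)%N.
Proof. by case: (projT2 (cid (separating_columns T))). Qed.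

Lemma separatorsP n (T : {set oracle n}) (g h : oracle n) :
  g \in T -> h \in T -> {in separators T, g =1 h} -> g = h.
Proof. by case: (projT2 (cid (separating_columns T))) => _; apply. Qed.

(** A tie counts as [false]; either answer then leaves exactly half of the set. *)
Definition majority n (T : {set oracle n}) : oracle n :=
  [ffun x => (#|T| < 2 * #|[set g in T | g x]|)%N].

Lemma minority_half n (T : {set oracle n}) x b : b != majority T x ->
  (2 * #|[set g : oracle n in T | g x == b]| <= #|T|)%N.
Proof.
rewrite ffunE => bx.
have split_card := cardsID [set g : oracle n | g x] T.
have eT : [set g : oracle n in T | g x] = T :&: [set g : oracle n | g x].
  by apply/setP => g; rewrite !inE.
have eF : [set g : oracle n in T | g x == false] = T :\: [set g : oracle n | g x].
  by apply/setP => g; rewrite !inE; case: (g x); rewrite ?andbT ?andbF.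
case: b bx => bx; last first.
  move: bx; rewrite eF eT; case: ltnP => //.
  by rewrite -split_card !mul2n -!addnn ltn_add2l leq_add2r => /ltnW.
have -> : [set g : oracle n in T | g x == true] = T :&: [set g : oracle n | g x].
  by apply/setP => g; rewrite !inE eqb_id.
by move: bx; rewrite eT; case: ltnP.
Qed.

(** Testing [x \in separators T] discards the default column of [nth] when it is not a separator: a
    settled oracle may contradict the majority there. *)
Definition refine n (T : {set oracle n}) (x : n.-tuple bool) (b : bool) :
    {set oracle n} :=
  if (x \in separators T) && (b != majority T x)
  then [set g in T | g x == b] else T.

Definition settled n (T : {set oracle n}) (f : oracle n) : bool :=
  all (fun x => f x == majority T x) (separators T).

(* A settled oracle never contradicts the majority on a separating column, so
   [T] is never refined again and the condition persists. *)
Definition good n (m : nat) (f : oracle n) (T : {set oracle n}) : bool :=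
  (f \in T) && (settled T f || (#|T| <= 2 ^ m)%N).

Lemma good_refine n m (T : {set oracle n}) (f : oracle n) x :
  good m f T -> good m f (refine T x (f x)).
Proof.
rewrite /refine; case: ifP => // /andP[xs fx] /andP[fT].
case/orP => [/allP/(_ x xs)|Tm]; first by rewrite (negPf fx).
rewrite /good inE fT eqxx /=; apply/orP; right; apply: leq_trans Tm.
by apply: subset_leq_card; apply/subsetP => g; rewrite inE => /andP[].
Qed.

Lemma refine_progress n m (T : {set oracle n}) (f : oracle n) x :
  f \in T -> (#|T| <= 2 ^ m.+1)%N ->
  x \in separators T -> f x != majority T x -> good m f (refine T x (f x)).
Proof.
move=> fT Tm xs fx; rewrite /refine xs fx /good inE fT eqxx /=.
apply/orP; right; have := leq_trans (minority_half fx) Tm.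
by rewrite expnS leq_mul2l.
Qed.

Definition guess n (T : {set oracle n}) : oracle n :=
  if [pick g in T | settled T g || (#|T| <= 1)%N] is Some g then g
  else [ffun=> false].

(** Two settled candidates both coincide with the majority on the separating columns, hence are
    equal. *)
Lemma good_guess n (T : {set oracle n}) (f : oracle n) :
  good 0 f T -> guess T = f.
Proof.
move=> /andP[fT fTs]; rewrite /guess; case: pickP => [g /andP[gT gTs]|/(_ f)].
  have [/card_le1_eqP T1|T1] := boolP (#|T| <= 1)%N; first exact: T1.
  move: gTs fTs; rewrite expn0 (negPf T1) !orbF => /allP gs /allP fs.
  by apply: separatorsP gT fT _ => x xs; rewrite (eqP (gs x xs)) (eqP (fs x xs)).
by rewrite fT fTs.
Qed.

(** * One attempt: Grover search and a classical query of the column found *)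

Definition iterations (m : nat) : nat := 4 * 2 ^ uphalf m.

(* Labels with second component [false] are never marked: they keep the
   fraction of marked labels at most 1/2, as [grover_success] requires. *)
Definition label_query n (T : {set oracle n}) m (l : 'I_(2 ^ m) * bool) : query n :=
  (nth (nseq_tuple n false) (separators T) l.1,
   l.2 && (l.1 < size (separators T))%N).

Definition search (R : realType) n (T : {set oracle n}) m
    (l : 'I_(2 ^ m) * bool) (f g : oracle n) : R :=
  \sum_(j < iterations m) (iterations m)%:R^-1 *
    (grover_state R (@label_query n T m) (majority T) f j l *
     grover_state R (@label_query n T m) (majority T) g j l).

(** The search may return an unmarked label. Querying its column classically keeps the refinement
    sound in every case. *)
Definition attempt (R : realType) n m (T T' : {set oracle n}) (f g : oracle n) : R :=
  \sum_(lb : ('I_(2 ^ m) * bool) * bool |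
        refine T (label_query T lb.1).1 lb.2 == T')
    search R T lb.1 f g *
    ((f (label_query T lb.1).1 == lb.2)%:R * (g (label_query T lb.1).1 == lb.2)%:R).

Lemma card_labels m : #|{: 'I_(2 ^ m) * bool}| = (2 * 2 ^ m)%N.
Proof. by rewrite card_prod card_ord card_bool mulnC. Qed.

Lemma measured_search (R : realType) n m (T : {set oracle n}) :
  measured (iterations m) (search R T (m := m)).
Proof.
apply: measured_grover; first by rewrite card_labels muln_gt0 expn_gt0.
by rewrite muln_gt0 expn_gt0.
Qed.

Lemma measured_attempt (R : realType) n m (T : {set oracle n}) :
  measured (iterations m + 1) (attempt R m T).
Proof.
apply: (measured_map _ (measured_pair (measured_search R m T)
  (fun l => measured_classical R (label_query T l).1))).
Qed.

Lemma prob_attempt (R : realType) n m (T : {set oracle n}) (f : oracle n) P :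
  prob (attempt R m T) f P = prob (search R T (m := m)) f
    (fun l => P (refine T (label_query T l).1 (f (label_query T l).1))).
Proof.
pose out (lb : ('I_(2 ^ m) * bool) * bool) := refine T (label_query T lb.1).1 lb.2.
rewrite /prob /attempt [RHS]big_mkcond /=.
pose G (l : 'I_(2 ^ m) * bool) b : R := search R T l f f *
  ((f (label_query T l).1 == b)%:R * (f (label_query T l).1 == b)%:R).
transitivity (\sum_(lb | P (out lb)) G lb.1 lb.2).
  rewrite (partition_big out P) //; apply: eq_bigr => T' PT'.
  by apply: eq_bigl => lb; rewrite -/(out lb); case: eqP => [->|]; rewrite ?PT' ?andbF.
rewrite [LHS]big_mkcond /=.
rewrite -(pair_bigA _ (fun l b =>
  if P (refine T (label_query T l).1 b) then G l b else 0)) /=.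
apply: eq_bigr => l _; rewrite (bigD1 (f (label_query T l).1)) //= big1 => [|b bf].
  by rewrite addr0 /G eqxx !mulr1.
by rewrite /G eq_sym (negPf bf) mul0r mulr0 if_same.
Qed.

Lemma prob_le1 (R : realType) n t (A : finType)
    (K : A -> oracle n -> oracle n -> R) f (P : pred A) :
  measured t K -> prob K f P <= 1.
Proof. by move=> mK; rewrite (prob_predC f P mK) gerBl (prob_ge0 f _ mK). Qed.

Lemma prob_le (R : realType) n t (A : finType)
    (K : A -> oracle n -> oracle n -> R) f (P Q : pred A) :
  measured t K -> subpred P Q -> prob K f P <= prob K f Q.
Proof.
move=> [gK _] PQ; rewrite /prob [leLHS]big_mkcond [leRHS]big_mkcond /=.
apply: ler_sum => a _; case: ifP => [/PQ -> //|_].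
by case: ifP => // _; apply: gram_diag_ge0.
Qed.

Lemma attempt_good (R : realType) n m k (T : {set oracle n}) (f : oracle n) :
  good k f T -> prob (attempt R m T) f (predC (good k f)) = 0.
Proof.
move=> gT; rewrite prob_attempt /prob big_pred0 // => l /=.
by rewrite good_refine.
Qed.

(** Unless [f] is already good at level [m], it is unsettled and [T] has at most 2^(m+1) elements.
    All separating columns then have labels, and one of these is marked. *)
Lemma attempt_progress (R : realType) n m (T : {set oracle n}) (f : oracle n) :
  good m.+1 f T -> prob (attempt R m.+1 T) f (predC (good m f)) <= 3 / 4.
Proof.
move=> gT; have [gT'|] := boolP (good m f T); first by rewrite attempt_good ?divr_ge0.
move: gT => /andP[fT fTs]; rewrite /good fT /= negb_or => /andP[unsettled _].
move: fTs; rewrite (negPf unsettled) /= => Tm.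
have /allPn[x xs fx] := unsettled.
have mE := measured_attempt R m.+1 T.
rewrite (prob_predC f _ mE).
suff : 1 / 4 <= prob (attempt R m.+1 T) f (good m f).
  rewrite /prob (eq_bigl (predC (predC (good m f)))) => [|T']; last by rewrite /= negbK.
  by lra.
rewrite prob_attempt.
have lt_s : (index x (separators T) < 2 ^ m.+1)%N.
  by apply: leq_trans (leq_trans (size_separators T) Tm); rewrite index_mem.
have marked_good : subpred (marked (@label_query n T m.+1) (majority T) f)
    (fun l => good m f (refine T (label_query T l).1 (f (label_query T l).1))).
  move=> l /andP[/= /andP[_ ls] fl].
  by apply: refine_progress => //; apply: mem_nth.
apply: le_trans (prob_le f (measured_search R m.+1 T) marked_good).
apply: grover_success.
- by rewrite card_labels muln_gt0 expn_gt0.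
- apply/card_gt0P; exists (Ordinal lt_s, true).
  by rewrite unfold_in /label_query /= index_mem xs nth_index.
- rewrite card_labels leq_mul2l /=.
  have cardE : (2 ^ m.+1)%N = #|[set p : 'I_(2 ^ m.+1) * bool | p.2]|.
    have -> : [set p : 'I_(2 ^ m.+1) * bool | p.2] = setX setT [set true].
      by apply/setP => -[i b]; rewrite !inE; case: b.
    by rewrite cardsX cardsT card_ord cards1 muln1.
  rewrite [leqRHS]cardE; apply: subset_leq_card; apply/subsetP => l.
  by rewrite unfold_in inE => /andP[/andP[]].
(* The factor 4 in [iterations] gives 4 J^2 >= 64 M, against the required 25 (2 M), with M =
   2^(m+1). *)
- rewrite card_labels /iterations expnMn -expnM.
  have : (2 ^ m.+1 <= 2 ^ (uphalf m.+1 * 2))%N by rewrite leq_exp2l //; lia.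
  by lia.
Qed.

(** * Total error and total cost of the successive halvings *)

Definition bad_prob (R : realType) n (m : nat)
    (K : {set oracle n} -> oracle n -> oracle n -> R) (f : oracle n) : R :=
  prob K f (predC (good m f)).

Definition attempt_after (R : realType) n m
    (K : {set oracle n} -> oracle n -> oracle n -> R)
    (T' : {set oracle n}) (f g : oracle n) : R :=
  \sum_T K T f g * attempt R m T T' f g.

Lemma attempt_afterE (R : realType) n m
    (K : {set oracle n} -> oracle n -> oracle n -> R) f P :
  prob (attempt_after m K) f P = \sum_T K T f f * prob (attempt R m T) f P.
Proof.
by rewrite /prob exchange_big; apply: eq_bigr => T _; rewrite mulr_sumr.
Qed.

Lemma good_succ n m (f : oracle n) T : good m f T -> good m.+1 f T.
Proof.
move=> /andP[fT fTs]; rewrite /good fT /=; case/orP: fTs => [-> //|Tm].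
by rewrite (leq_trans Tm) ?orbT // leq_exp2l.
Qed.

(** Let p and p' be the bad probabilities at levels m+1 and m. Sets bad at level m+1 may stay bad,
    those bad only at level m fail with probability at most 3/4, and good ones stay good: p +
    (3/4)(p' - p) in all. *)
Lemma attempt_after_bad (R : realType) n t m
    (K : {set oracle n} -> oracle n -> oracle n -> R) f :
  measured t K ->
  bad_prob m.+1 (attempt_after m.+1 K) f <= bad_prob m.+1 K f /\
  bad_prob m (attempt_after m.+1 K) f <=
    1 / 4 * bad_prob m.+1 K f + 3 / 4 * bad_prob m K f.
Proof.
move=> [gK _]; have K0 T : 0 <= K T f f by apply: gram_diag_ge0.
have le1 k T : prob (attempt R m.+1 T) f (predC (good k f)) <= 1.
  by apply: prob_le1; apply: measured_attempt.
rewrite /bad_prob !attempt_afterE; split.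
  rewrite /prob [leRHS]big_mkcond /=; apply: ler_sum => T _.
  case: ifPn => [_|/negPn gT]; first by rewrite ler_piMr //; apply: le1.
  by rewrite -/(prob (attempt R m.+1 T) f (predC (good m.+1 f))) attempt_good ?mulr0.
rewrite {2 3}/prob [X in 1 / 4 * X]big_mkcond [X in 3 / 4 * X]big_mkcond /=.
rewrite !mulr_sumr -big_split /=; apply: ler_sum => T _.
have le_T := le1 m T; have K0T := K0 T.
have [gT|ngT] := boolP (good m.+1 f T).
  have [gT'|ngT'] /= := boolP (good m f T); first by rewrite attempt_good // !mulr0 addr0.
  have := attempt_progress R gT; nra.
have /negPf -> /= : ~~ good m f T by apply: contra ngT; apply: good_succ.
nra.
Qed.

Lemma stage (R : realType) n (S : {set oracle n}) m r t
    (K : {set oracle n} -> oracle n -> oracle n -> R) e :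
  measured t K -> {in S, forall f, bad_prob m.+1 K f <= e} ->
  exists K', measured (t + r * (iterations m.+1 + 1)) K' /\
    {in S, forall f, bad_prob m K' f <= e + (3 / 4) ^+ r}.
Proof.
move=> mK Ke.
(* The bound at level [m.+1] must be carried along: an attempt turns e + p into at most e/4 +
   (3/4)(e + p) = e + (3/4) p. *)
suff [K' [mK' K'e _]] : exists K',
  [/\ measured (t + r * (iterations m.+1 + 1)) K',
      {in S, forall f, bad_prob m K' f <= e + (3 / 4) ^+ r} &
      {in S, forall f, bad_prob m.+1 K' f <= e}] by exists K'.
elim: r => [|r [K' [mK' K'e K'e1]]].
  exists K; rewrite mul0n addn0; split=> // f fS.
  apply: le_trans (prob_le1 _ _ mK) _.
  by rewrite expr0 lerDr (le_trans _ (Ke f fS)) // (prob_ge0 _ _ mK).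
exists (attempt_after m.+1 K'); rewrite mulSnr addnA; split.
- exact: measured_bind mK' (measured_attempt R m.+1).
- move=> f fS; have [_] := attempt_after_bad m f mK'.
  have := K'e f fS; have := K'e1 f fS; rewrite exprS.
  set p := (3 / 4) ^+ r; lra.
- move=> f fS; have [le_bad _] := attempt_after_bad m f mK'.
  exact: le_trans le_bad (K'e1 f fS).
Qed.

Fixpoint cost (m c : nat) : nat :=
  if m is m'.+1 then (c * (iterations m + 1) + cost m' c.+1)%N else 0%N.

(** The constant 4 is the geometric series of ratio 3/4: (3/4)^c + 4 (3/4)^(c+1) = 4 (3/4)^c. *)
Lemma stages (R : realType) n (S : {set oracle n}) m c t
    (K : {set oracle n} -> oracle n -> oracle n -> R) e :
  measured t K -> {in S, forall f, bad_prob m K f <= e} ->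
  exists K', measured (t + cost m c) K' /\
    {in S, forall f, bad_prob 0 K' f <= e + 4 * (3 / 4) ^+ c}.
Proof.
elim: m c t K e => [|m IHm] c t K e mK Ke.
  exists K; rewrite addn0; split=> // f fS; apply: le_trans (Ke f fS) _.
  by rewrite lerDl mulr_ge0 // exprn_ge0 // divr_ge0.
have [K1 [mK1 K1e]] := stage c mK Ke.
have [K2 [mK2 K2e]] := IHm c.+1 _ _ _ mK1 K1e.
exists K2; rewrite addnA; split=> // f fS; apply: le_trans (K2e f fS) _.
by rewrite exprS; set p := (3 / 4) ^+ c; lra.
Qed.

(** Induction by two levels, over which the power u of two doubles: the two stages cost at most (2c
    + 1) 9u, and (18c + 9) + (20c + 90) <= 2 (20c + 50). *)
Lemma cost_le m c : (cost m c <= (20 * c + 50) * 2 ^ uphalf m)%N.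
Proof.
elim/ltn_ind: m c => -[|[|m]] IHm c //.
  by rewrite /= /iterations /=; lia.
rewrite [cost _ _]/= -/(cost m.+1 c.+1) /=.
have := IHm m (leqnSn _) c.+2.
have e2 : (2 ^ uphalf m.+2 = 2 * 2 ^ uphalf m)%N by rewrite /= expnS.
have e1 : (2 ^ uphalf m.+1 <= 2 * 2 ^ uphalf m)%N.
  by rewrite -expnS leq_exp2l //; lia.
have u0 : (0 < 2 ^ uphalf m)%N by rewrite expn_gt0.
rewrite -[(uphalf m).+1]/(uphalf m.+2) /iterations e2.
move: e1 u0; set u := (2 ^ uphalf m)%N; set u1 := (2 ^ uphalf m.+1)%N.
move=> *; nia.
Qed.

Lemma measured_candidates (R : realType) n (S : {set oracle n}) m c :
  (#|S| <= 2 ^ m)%N ->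
  exists K : {set oracle n} -> oracle n -> oracle n -> R,
    measured (cost m c) K /\
    {in S, forall f, bad_prob 0 K f <= 4 * (3 / 4) ^+ c}.
Proof.
move=> Sm.
pose K0 (T : {set oracle n}) (f g : oracle n) : R := (S == T)%:R.
have mK0 : measured 0 K0.
  split=> [T|f g]; last exact: sum_eqb.
  by apply: gram_const; rewrite ler0n.
have [|K [mK Ke]] := stages c mK0 (S := S) (m := m) (e := 0).
  move=> f fS; rewrite /bad_prob /prob big1 // => T.
  rewrite /K0; case: eqP => // <- /=.
  by rewrite /good fS Sm orbT.
by exists K; split=> // f fS; rewrite -[leRHS]add0r; apply: Ke.
Qed.

(** * The query bound *)

Lemma solvable_cost (R : realType) n (S : {set oracle n}) m :
  (#|S| <= 2 ^ m)%N -> solvable_with R S (cost m 9).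
Proof.
move=> /(measured_candidates R 9)[K [mK Ke]].
have [A AE] := measured_algorithm (measured_map (@guess n) mK).
exists A => f fS; rewrite AE.
apply: (@le_trans _ _ (prob K f (good 0 f))); last first.
  apply: (@prob_le _ _ _ _ _ _ _ (fun T => guess T == f) mK) => T.
  by move=> /good_guess ->.
rewrite (prob_predC f _ mK); have := Ke f fS; rewrite /bad_prob => le_bad.
(* The choice of 9 makes 4 (3/4)^9, about 0.3003, smaller than 1/3. *)
by lra.
Qed.

Theorem theorem3 (R : realType) :
  exists (C : R) (N0 : nat), 0 < C /\
    forall (n : nat) (S : {set oracle n}),
      (N0 <= 2 ^ n)%N -> #|S| = (2 ^ n)%N ->
      exists q : nat, is_query_complexity R S q /\
        q%:R <= C * Num.sqrt ((2 ^ n)%N%:R).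
Proof.
(* The constant is 2 times 230 = 20 * 9 + 50; the factor 2 covers rounding up, as 2^(uphalf n) <= 2
   sqrt(2^n). *)
exists 460, 0%N; split=> [|n S _ cardS]; first by [].
have solved : solvable_with R S (cost n 9) by apply: solvable_cost; rewrite cardS.
have ex_solved : exists t, `[< solvable_with R S t >].
  by exists (cost n 9); apply/asboolP.
case: (ex_minnP ex_solved) => q /asboolP Sq q_min.
exists q; split; first by split=> // t St; apply: q_min; apply/asboolP.
have le_cost : (q <= 230 * 2 ^ uphalf n)%N.
  by apply: leq_trans (cost_le n 9); apply: q_min; apply/asboolP.
apply: (@le_trans _ _ ((230 * 2 ^ uphalf n)%N%:R)); first by rewrite ler_nat.
have -> : 460 = 230 * 2 :> R by ring.
rewrite natrM -mulrA ler_pM2l // -(@ler_pXn2r _ 2) ?nnegrE ?mulr_ge0 ?sqrtr_ge0 //.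
rewrite exprMn sqr_sqrtr // -!natrX -natrM ler_nat -expnM -expnD leq_exp2l //.
lia.
Qed.
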